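(* Let $F$ be a finite field. Then: (1) If $|F|\leq 4$, then $\Gamma(\mathbb{Z}_2\times \mathbb{Z}_2 \times F)$ is partitionable into global defensive alliances with $\psi_g(\Gamma(\mathbb{Z}_2\times \mathbb{Z}_2\times F))=2$. (2) If $|F|>4$, then $\Gamma(\mathbb{Z}_2 \times \mathbb{Z}_2 \times F)$ is not partitionable into global defensive alliances.
   Context: $\mathbb{Z}_n=\mathbb{Z}/n\mathbb{Z}$. For a commutative ring $R$ with $1\neq 0$, the zero-divisor graph $\Gamma(R)$ is the simple graph whose vertices are the nonzero zero-divisors of $R$, two distinct vertices $x,y$ being adjacent if and only if $xy=0$. Let $\Gamma=(V,E)$ be a finite simple graph. For $S\subseteq V$ put $\bar S=V\setminus S$ and $\deg_S(x)=|S\cap N(x)|$, where $N(x)$ is the set of vertices adjacent to $x$. A nonempty $S\subseteq V$ is a dominating set if $\deg_S(v)>0$ for every $v\in\bar S$; it is a defensive alliance if $\deg_S(x)+1\ge \deg_{\bar S}(x)$ for every $x\in S$; it is a global defensive alliance if it is both. The global defensive alliance partition number $\psi_g(\Gamma)$ is the maximum number of sets in a partition of $V$ such that each set is a global defensive alliance; $\Gamma$ is partitionable into global defensive alliances if $\psi_g(\Gamma)\ge 2$. *)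

(* Defs.v *)
From HB Require Import structures.
From mathcomp Require Import all_boot all_order all_algebra.

Set Implicit Arguments.
Unset Strict Implicit.
Unset Printing Implicit Defensive.

Import GRing.Theory.

(* The library makes R * S a finite type and a commutative ring separately; this
   declares the join. *)
HB.instance Definition _ (R S : finComNzRingType) :=
  GRing.ComNzRing.on (R * S)%type.

Record sgraph := SGraph {
  vertex :> finType;
  adj : rel vertex;
  adj_sym : symmetric adj;
  adj_irrefl : irreflexive adj }.

Section Alliances.
Variable G : sgraph.
Implicit Types (S : {set G}) (P : {set {set G}}).

Definition neighbors (x : G) : {set G} := [set y | adj x y].

Definition deg_in S (x : G) : nat := #|S :&: neighbors x|.

Definition dominating_set S : bool :=
  (S != set0) && [forall v in ~: S, 0 < deg_in S v].

Definition defensive_alliance S : bool :=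
  (S != set0) && [forall x in S, deg_in (~: S) x <= deg_in S x + 1].

Definition global_defensive_alliance S : bool :=
  dominating_set S && defensive_alliance S.

Definition gda_partition P : bool :=
  partition P [set: G] && [forall S in P, global_defensive_alliance S].

(* When G is nonempty, the one-block partition is admissible, so this maximum
   is taken over a nonempty family. *)
Definition psi_g : nat := \max_(P : {set {set G}} | gda_partition P) #|P|.

Definition gda_partitionable : bool := 2 <= psi_g.

End Alliances.

Section ZeroDivisorGraph.
Variable R : finComNzRingType.
Local Open Scope ring_scope.

Definition zero_divisor (x : R) : bool :=
  [exists y : R, (y != 0) && (x * y == 0)].

Definition zdg_vertex : finType := {x : R | (x != 0) && zero_divisor x}.

Definition zdg_adj : rel zdg_vertex :=
  fun x y => (x != y) && (val x * val y == 0).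

Lemma zdg_adj_sym : symmetric zdg_adj.
Proof. by move=> x y; rewrite /zdg_adj eq_sym mulrC. Qed.

Lemma zdg_adj_irrefl : irreflexive zdg_adj.
Proof. by move=> x; rewrite /zdg_adj eqxx. Qed.

Definition zero_divisor_graph : sgraph := SGraph zdg_adj_sym zdg_adj_irrefl.

End ZeroDivisorGraph.

(* Main.v *)
(* Each (1,0,u) with u a unit is a leaf attached to (0,1,0), and each (0,1,u) is a
   leaf attached to (1,0,0). A dominating set meets {leaf, neighbor}, so a
   partition into global defensive alliances has at most two blocks S and T; let
   S contain (0,1,0), so that T contains all the (1,0,u). Put m = |F| - 1 and let
   c be the number of (0,0,u) in S.
   If T contains (1,0,0), the alliance conditions at (0,1,0) in S and at (1,0,0)
   in T add up to 2m <= 0, which is absurd. So (1,0,0) is in S, all the (0,1,u)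
   are in T, and the condition at (1,0,0) reads m + (m - c) <= c + 2. If (1,1,0)
   is in S, the (0,0,u) must be dominated by T, so c = 0 and m <= 1; otherwise the
   condition at (1,1,0) reads c <= (m - c) + 1, whence m <= 3.
   Conversely, for m <= 3, S made of (1,0,0), (0,1,0) and max(1, m - 1) of the
   (0,0,u), and its complement, are global defensive alliances. *)
Require Import Defs.
From HB Require Import structures.
From mathcomp Require Import all_boot all_order all_algebra.
From mathcomp Require Import zify.

Set Implicit Arguments.
Unset Strict Implicit.
Unset Printing Implicit Defensive.

Import GRing.Theory.

(** * Partitions of a graph with a leaf into global defensive alliances *)

Section Partitions.
Variable G : sgraph.
Implicit Types (S : {set G}) (P : {set {set G}}).

Lemma gda_dominates S x :
  global_defensive_alliance S -> (x \in S) || (0 < deg_in S x).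
Proof.
case/andP=> /andP[_ /forall_inP dS] _; case: (boolP (x \in S)) => //= xS.
by apply: dS; rewrite inE.
Qed.

Lemma gda_defends S x :
  global_defensive_alliance S -> x \in S -> deg_in (~: S) x <= deg_in S x + 1.
Proof. by case/andP=> _ /andP[_ /forall_inP aS]; apply: aS. Qed.

Lemma gda_leaf S x y :
  @neighbors G x = [set y] -> global_defensive_alliance S -> (x \in S) || (y \in S).
Proof.
move=> nx gS; have /orP[->//|] := gda_dominates x gS.
rewrite /deg_in nx card_gt0 => /set0Pn[z]; rewrite !inE => /andP[zS /eqP zy].
by rewrite -zy zS orbT.
Qed.

(** Each block contains [x] or [y], so it is the block of one of them. *)
Lemma card_gda_partition_leaf x y P :
  @neighbors G x = [set y] -> gda_partition P -> #|P| <= 2.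
Proof.
move=> nx /andP[/and3P[_ tP _] /forall_inP gP].
suff /subset_leq_card/leq_trans : P \subset [set pblock P x; pblock P y].
  by apply; rewrite cards2; case: eqP.
apply/subsetP => S SP; rewrite !inE.
by have /orP[xS|yS] := gda_leaf nx (gP _ SP);
  rewrite ?(def_pblock tP SP xS) ?(def_pblock tP SP yS) eqxx ?orbT.
Qed.

Lemma psi_g_leaf x y : @neighbors G x = [set y] -> psi_g G <= 2.
Proof. by move=> nx; apply/bigmax_leqP => P; apply: card_gda_partition_leaf nx. Qed.

Lemma gda_partitionable_setC S :
  global_defensive_alliance S -> global_defensive_alliance (~: S) ->
  gda_partitionable G.
Proof.
move=> gS gC.
have S0 : S != set0 by case/andP: gS => /andP[].
have C0 : ~: S != set0 by case/andP: gC => /andP[].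
have SC : S != ~: S.
  by apply: contraNneq S0 => SC; rewrite -(setIid S) {2}SC setICr.
have gP : gda_partition [set S; ~: S].
  apply/andP; split; last by apply/forall_inP => T; rewrite !inE => /orP[] /eqP->.
  apply/and3P; split.
  - by rewrite /cover bigcup_setU !big_set1 setUCr.
  - apply/trivIsetP => A B; rewrite !inE => /orP[] /eqP-> /orP[] /eqP->;
      by rewrite ?eqxx // -setI_eq0 ?setICr // setIC setICr.
  - by rewrite !inE negb_or eq_sym S0 eq_sym.
by apply: leq_trans (leq_bigmax_cond _ gP); rewrite cards2 SC.
Qed.

Lemma gda_partitionable_leaf x y :
  @neighbors G x = [set y] -> gda_partitionable G ->
  exists2 S : {set G}, global_defensive_alliance S & global_defensive_alliance (~: S).
Proof.
move=> nx; rewrite /gda_partitionable => psi2.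
(* If no admissible partition had more than one block, the maximum would be at most 1. *)
case: (boolP [exists P : {set {set G}}, gda_partition P && (1 < #|P|)]); last first.
  rewrite negb_exists => /forallP nP; move: psi2; rewrite ltnNge => /negP[].
  apply/bigmax_leqP => P gP; have := nP P; by rewrite gP /= -leqNgt.
case/existsP=> P /andP[gP P2].
have P2' := card_gda_partition_leaf nx gP.
have /cards2P[S [T [ST PE]]] : #|P| == 2 by rewrite eqn_leq P2' P2.
case/andP: gP => /and3P[/eqP cP /trivIsetP tP _] /forall_inP gP.
exists S; first by apply: gP; rewrite PE !inE eqxx.
have -> : ~: S = T; last by apply: gP; rewrite PE !inE eqxx orbT.
have := tP S T; rewrite PE !inE !eqxx orbT => /(_ isT isT ST).
rewrite -setI_eq0 => /eqP dST.
move: cP; rewrite PE /cover bigcup_setU !big_set1 => cST.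
apply/setP => z; move/setP/(_ z): dST; move/setP/(_ z): cST; rewrite !inE.
by do 2!case: (z \in _).
Qed.

End Partitions.

Lemma mem_neighbors (R : finComNzRingType) (v w : zero_divisor_graph R) :
  (w \in neighbors v) = (val v != val w) && (val v * val w == 0)%R.
Proof. by rewrite inE /= /zdg_adj val_eqE. Qed.

(** * The ring and its zero-divisors in coordinates *)

Section Graph.
Variable F : finFieldType.
Local Open Scope ring_scope.
Notation R := ('Z_2 * 'Z_2 * F)%type.
Notation G := (zero_divisor_graph R).
Implicit Types (S : {set G}) (v : G).

(* Encodes the 'Z_2 components as booleans, so that their products compute. *)
Definition elt (a b : bool) (u : F) : R := (a%:R, b%:R, u).

Lemma natb_Z2_eq0 (a : bool) : (a%:R == 0 :> 'Z_2) = ~~ a.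
Proof. by case: a. Qed.

Lemma natb_Z2K (i : 'Z_2) : (i != 0)%:R = i.
Proof. by case: i => [[|[|//]] h]; apply: val_inj. Qed.

Lemma eltP (x : R) : x = elt (x.1.1 != 0) (x.1.2 != 0) x.2.
Proof. by case: x => [[i j] u]; rewrite /elt !natb_Z2K. Qed.

Lemma elt_eq0 a b u : (elt a b u == 0) = [&& ~~ a, ~~ b & u == 0].
Proof.
have -> : (elt a b u == 0) =
    [&& a%:R == 0 :> 'Z_2, b%:R == 0 :> 'Z_2 & u == 0] by rewrite andbA.
by rewrite !natb_Z2_eq0.
Qed.

Lemma mul_elt a b u a' b' u' :
  elt a b u * elt a' b' u' = elt (a && a') (b && b') (u * u').
Proof. by rewrite /elt -!mulnb !natrM. Qed.

Lemma eq_elt a b u a' b' u' :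
  (elt a b u == elt a' b' u') = [&& a == a', b == b' & u == u'].
Proof. by rewrite !xpair_eqE -andbA; case: a a' => [] []; case: b b' => [] []. Qed.

Lemma sum_elt (f : R -> nat) :
  (\sum_x f x = \sum_a \sum_b \sum_u f (elt a b u))%N.
Proof.
have sumZ2 (g : 'Z_2 -> nat) : (\sum_i g i = \sum_(a : bool) g a%:R)%N.
  by rewrite big_bool big_ord_recl big_ord1 addnC; congr (g _ + g _)%N; apply: val_inj.
under [RHS]eq_bigr do rewrite -(sumZ2 (fun j => \sum_u f (_, j, u))%N).
rewrite -(sumZ2 (fun i => \sum_j \sum_u f (i, j, u))%N).
by rewrite (pair_bigA _ _) (pair_bigA _ _); apply: eq_bigr => -[[]].
Qed.

(** Nonzero and not a unit; in a product of fields these are the nonzero zero-divisors. *)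
Definition is_vertex (a b : bool) (u : F) :=
  [|| a, b | u != 0] && [|| ~~ a, ~~ b | u == 0].

(* The annihilator of [elt a b u] is generated by the complementary idempotent. *)
Lemma is_vertexE a b u : (elt a b u != 0) && zero_divisor (elt a b u) = is_vertex a b u.
Proof.
rewrite /is_vertex elt_eq0 !negb_and !negbK; congr (_ && _).
apply/existsP/idP => [[x]|nd].
  rewrite (eltP x) mul_elt !elt_eq0 mulf_eq0.
  by case: a b (u == 0) => [] [] [] //=; case: (_ != _); case: (_ != _); case: eqP.
exists (elt (~~ a) (~~ b) (u == 0)%:R); rewrite mul_elt !elt_eq0 !andbN.
by move: nd; have [->|u0] := eqVneq u 0; case: a b => [] [] //=;
  rewrite ?mul0r ?mulr0 ?oner_eq0 ?eqxx.
Qed.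

(** Membership is tested in the ring, so it makes sense for every triple and is false off the
    vertices. *)
Definition mem_elt S (a b : bool) (u : F) : bool :=
  elt a b u \in [set val v | v in S].

Lemma mem_elt_val S v a b u : val v = elt a b u -> mem_elt S a b u = (v \in S).
Proof. by move=> vE; rewrite /mem_elt -vE mem_imset //; apply: val_inj. Qed.

Lemma ex_vertex a b u : is_vertex a b u -> exists v : G, val v = elt a b u.
Proof. by rewrite -is_vertexE => h; exists (Sub (elt a b u) h). Qed.

Lemma vertex_elt v : exists a b u, is_vertex a b u /\ val v = elt a b u.
Proof.
exists ((val v).1.1 != 0), ((val v).1.2 != 0), (val v).2.
by rewrite -is_vertexE -!eltP (valP v).
Qed.

Lemma mem_elt_vertex S a b u : mem_elt S a b u -> is_vertex a b u.
Proof. by case/imsetP=> v _ vE; rewrite -is_vertexE vE (valP v). Qed.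

Lemma mem_elt_nonvertex S a b u : ~~ is_vertex a b u -> mem_elt S a b u = false.
Proof. by move=> nv; apply/negbTE; apply: contra nv; apply: mem_elt_vertex. Qed.

Lemma mem_eltC S a b u : mem_elt (~: S) a b u = is_vertex a b u && ~~ mem_elt S a b u.
Proof.
case: (boolP (is_vertex a b u)) => [/ex_vertex[v vE]|]; last exact: mem_elt_nonvertex.
by rewrite !(mem_elt_val _ vE) inE.
Qed.

(** * Degrees and alliance conditions in coordinates *)

Definition unit_count S a b : nat := (\sum_(u | (u != 0)%R) mem_elt S a b u)%N.

(** Counts the elements of [S] annihilated by (a,b,u): for nonzero u the third coordinate must be 0,
    for u = 0 it is arbitrary. *)
Definition elt_deg S (a b : bool) (u : F) : nat :=
  (\sum_a' \sum_b' ~~ (a && a') * ~~ (b && b') *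
     ((u == 0%R) * unit_count S a' b' + mem_elt S a' b' 0%R))%N.

Lemma deg_in_elt S v a b u : val v = elt a b u -> deg_in S v = elt_deg S a b u.
Proof.
move=> vE; have vx : is_vertex a b u by rewrite -is_vertexE -vE (valP v).
rewrite /deg_in -(card_imset _ val_inj) -sum1_card big_mkcond sum_elt.
apply: eq_bigr => a' _; apply: eq_bigr => b' _.
transitivity (\sum_u' [&& ~~ (a && a'), ~~ (b && b'), (u * u' == 0)%R
                          & mem_elt S a' b' u'])%N.
  apply: eq_bigr => u' _; set A := imset _ _.
  suff -> : (elt a' b' u' \in A) =
    [&& ~~ (a && a'), ~~ (b && b'), (u * u' == 0)%R & mem_elt S a' b' u'] by case: ifP.
  have := elt_eq0 (a && a') (b && b') (u * u'); rewrite -mul_elt -vE.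
  rewrite !(andbA _ _ (mem_elt _ _ _ _)) => <-.
  apply/imsetP/andP => [[w]|[vz /imsetP[w wS wE]]].
    rewrite inE mem_neighbors => /andP[wS /andP[nz vz]] zE.
    by rewrite /mem_elt zE vz imset_f.
  exists w => //; rewrite inE wS mem_neighbors -wE vz andbT andTb.
  (* [w] is not [v]: an element of square zero is zero, hence not a vertex. *)
  apply: contraTneq vx => vz'; move: vz; rewrite -vz' vE mul_elt elt_eq0.
  by rewrite !andbb mulf_eq0 orbb /is_vertex => /and3P[/negPf-> /negPf-> ->].
(* Separates u' = 0, which always annihilates u, from the nonzero u', which do so only if u = 0. *)
rewrite (bigD1 0) //= mulr0 eqxx addnC /unit_count mulnDr big_distrr big_distrr /=.
case: (~~ (a && a')) => /=; last by rewrite big1.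
case: (~~ (b && b')) => /=; last by rewrite big1.
rewrite !mul1n; congr (_ + _)%N; apply: eq_bigr => u' /negPf u0.
by rewrite mulf_eq0 u0 orbF; case: (u == 0); rewrite ?mul1n.
Qed.

(** With triples in place of vertices, cases on two booleans and on u = 0 run through all kinds of
    vertices. *)
Lemma gda_eltP S :
  reflect [/\ exists a b u, mem_elt S a b u,
              forall a b u, is_vertex a b u -> mem_elt S a b u || (0 < elt_deg S a b u)%N
            & forall a b u, mem_elt S a b u ->
                (elt_deg (~: S) a b u <= elt_deg S a b u + 1)%N]
          (global_defensive_alliance S).
Proof.
apply: (iffP idP) => [gS|[[a0 [b0 [u0 ne]]] dS aS]].
  split.
  - case/andP: (gS) => _ /andP[/set0Pn[v vS] _].
    have [a [b [u [_ vE]]]] := vertex_elt v.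
    by exists a, b, u; rewrite (mem_elt_val _ vE).
  - move=> a b u /ex_vertex[v vE].
    by rewrite (mem_elt_val _ vE) -(deg_in_elt _ vE); apply: gda_dominates.
  - move=> a b u h; have [v vE] := ex_vertex (mem_elt_vertex h).
    by rewrite -!(deg_in_elt _ vE); apply: gda_defends; rewrite -?(mem_elt_val _ vE).
have S0 : S != set0 by case/imsetP: ne => v vS _; apply/set0Pn; exists v.
rewrite /global_defensive_alliance /dominating_set /defensive_alliance S0 /=.
apply/andP; split; apply/forall_inP => v; have [a [b [u [vx vE]]]] := vertex_elt v.
  rewrite inE (deg_in_elt _ vE) => /negbTE vS.
  by have := dS _ _ _ vx; rewrite (mem_elt_val _ vE) vS.
by rewrite !(deg_in_elt _ vE) -(mem_elt_val S vE); apply: aS.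
Qed.

(** * Degrees of the six kinds of vertices *)

Lemma mem_elt000 S : mem_elt S false false 0 = false.
Proof. by apply: mem_elt_nonvertex; rewrite /is_vertex eqxx. Qed.

Lemma elt_deg100 S : elt_deg S true false 0 =
  (unit_count S false false + unit_count S false true + mem_elt S false true 0%R)%N.
Proof. rewrite /elt_deg !big_bool /= eqxx mem_elt000; lia. Qed.

Lemma elt_deg010 S : elt_deg S false true 0 =
  (unit_count S false false + unit_count S true false + mem_elt S true false 0%R)%N.
Proof. rewrite /elt_deg !big_bool /= eqxx mem_elt000; lia. Qed.

Lemma elt_deg110 S : elt_deg S true true 0 = unit_count S false false.
Proof. rewrite /elt_deg !big_bool /= eqxx mem_elt000; lia. Qed.

Lemma elt_deg00u S u : u != 0 -> elt_deg S false false u =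
  (mem_elt S true false 0%R + mem_elt S false true 0%R + mem_elt S true true 0%R)%N.
Proof. by move=> /negPf u0; rewrite /elt_deg !big_bool /= u0 mem_elt000; lia. Qed.

Lemma elt_deg10u S u : u != 0 -> elt_deg S true false u = mem_elt S false true 0.
Proof. by move=> /negPf u0; rewrite /elt_deg !big_bool /= u0 mem_elt000; lia. Qed.

Lemma elt_deg01u S u : u != 0 -> elt_deg S false true u = mem_elt S true false 0.
Proof. by move=> /negPf u0; rewrite /elt_deg !big_bool /= u0 mem_elt000; lia. Qed.

Lemma unit_count_full S a b :
  (forall u, u != 0 -> mem_elt S a b u) -> unit_count S a b = #|F|.-1.
Proof.
move=> full; rewrite /unit_count (eq_bigr (fun=> 1%N)) => [|u u0]; last by rewrite full.
by rewrite sum1_card -(cardC1 (0 : F)).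
Qed.

(** Unless a and b both hold, every (a,b,u) with u nonzero is a vertex. *)
Lemma unit_countC S a b : ~~ (a && b) ->
  (unit_count S a b + unit_count (~: S) a b = #|F|.-1)%N.
Proof.
move=> ab; rewrite -(cardC1 (0 : F)) /unit_count -big_split -sum1_card.
apply: eq_bigr => u /negPf u0; rewrite mem_eltC /is_vertex u0 !orbT /= orbF -negb_and ab.
by case: mem_elt.
Qed.

(** * The upper bound on |F| *)

Lemma card_le4_of_gda_setC S :
  global_defensive_alliance S -> global_defensive_alliance (~: S) -> (#|F| <= 4)%N.
Proof.
wlog bS : S / mem_elt S false true 0 => [wl|].
  case bS: (mem_elt S false true 0); first exact: wl.
  move=> gS gC; apply: (wl (~: S)); rewrite ?setCK //.
  by rewrite mem_eltC bS /is_vertex eqxx.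
move=> /gda_eltP[_ dS aS] /gda_eltP[_ dC aC]; rewrite setCK in aC.
have F2 : (1 < #|F|)%N by apply: card_finNzRing_gt1.
have bC : mem_elt (~: S) false true 0 = false by rewrite mem_eltC bS andbF.
(* The only neighbor (0,1,0) of the leaf (1,0,u) is in [S], so [~: S] must contain the leaf. *)
have nE : unit_count (~: S) true false = #|F|.-1.
  apply: unit_count_full => u u0; have := dC true false u; rewrite elt_deg10u // bC orbF.
  by apply; rewrite /is_vertex orbT.
have n00 := @unit_countC S false false isT.
have n10 := @unit_countC S true false isT.
have n01 := @unit_countC S false true isT.
case aI: (mem_elt S true false 0).
  have aI' : mem_elt (~: S) true false 0 = false by rewrite mem_eltC aI andbF.
  have nG : unit_count (~: S) false true = #|F|.-1.
    apply: unit_count_full => u u0; have := dC false true u; rewrite elt_deg01u // aI' orbF.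
    by apply; rewrite /is_vertex orbT.
  (* With m = |F| - 1 and c = [unit_count S false false], this says m <= c + 1. *)
  have := aS _ _ _ aI; rewrite !elt_deg100 bS bC.
  case dI: (mem_elt S true true 0).
    have dI' : mem_elt (~: S) true true 0 = false by rewrite mem_eltC dI andbF.
    (* All three neighbors of (0,0,u) are in [S]; hence c = 0 and m <= 1. *)
    have nC : unit_count (~: S) false false = #|F|.-1.
      apply: unit_count_full => u u0; have := dC false false u.
      by rewrite elt_deg00u // aI' bC dI' orbF; apply; rewrite /is_vertex u0.
    lia.
  (* Here 2c <= m + 1, which with m <= c + 1 gives m <= 3. *)
  have := aC true true 0; rewrite mem_eltC dI /is_vertex eqxx !elt_deg110 => /(_ isT); lia.
have aI' : mem_elt (~: S) true false 0 by rewrite mem_eltC aI /is_vertex eqxx.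
have nG : unit_count S false true = #|F|.-1.
  apply: unit_count_full => u u0; have := dS false true u; rewrite elt_deg01u // aI orbF.
  by apply; rewrite /is_vertex orbT.
(* The two bounds add up to 2m <= 0, against [F2]. *)
have := aC _ _ _ aI'; have := aS _ _ _ bS.
by rewrite !elt_deg100 !elt_deg010 aI aI' bS bC; lia.
Qed.

(** * Two complementary alliances for |F| <= 4 *)

(* (1,0,0), (0,1,0) and all the (0,0,u) but one, or all of them when |F| = 2. *)
Definition hub_elt (a b : bool) (u : F) :=
  if (a || b) then (a != b) && (u == 0) else (u != 1) || (#|F| == 2)%N.

Definition hub_set : {set G} :=
  [set v : G | hub_elt ((val v).1.1 != 0) ((val v).1.2 != 0) (val v).2].

(** [hub_elt] also holds at the zero triple, which [is_vertex] excludes. *)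
Lemma mem_elt_hub_set a b u : mem_elt hub_set a b u = is_vertex a b u && hub_elt a b u.
Proof.
case: (boolP (is_vertex a b u)) => [/ex_vertex[v vE]|]; last exact: mem_elt_nonvertex.
by rewrite (mem_elt_val _ vE) inE vE /= !natb_Z2_eq0 !negbK.
Qed.

Lemma unit_count_hub_set : unit_count hub_set false false = (#|F|.-1 - (#|F| != 2))%N.
Proof.
have [F2|F2] := eqVneq #|F| 2%N.
  rewrite F2 subn0 -F2; apply: unit_count_full => u u0.
  by rewrite mem_elt_hub_set /is_vertex /hub_elt /= u0 F2 orbT.
rewrite /unit_count (bigD1 (1 : F)) ?oner_eq0 //=.
rewrite mem_elt_hub_set /hub_elt /= eqxx (negPf F2) andbF add0n.
rewrite (eq_bigr (fun=> 1%N)) => [|u /andP[u0 u1]]; last first.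
  by rewrite mem_elt_hub_set /is_vertex /hub_elt /= u0 u1.
rewrite sum1_card -(cardC1 (0 : F)) (cardD1 1 (predC1 0)) !inE oner_eq0 addKn.
by apply: eq_card => u; rewrite !inE andbC.
Qed.

Lemma gda_hub_set : (#|F| <= 4)%N ->
  global_defensive_alliance hub_set /\ global_defensive_alliance (~: hub_set).
Proof.
move=> F4.
have F2 : (1 < #|F|)%N by apply: card_finNzRing_gt1.
have n00 := @unit_countC hub_set false false isT.
have n10 := @unit_countC hub_set true false isT.
have n01 := @unit_countC hub_set false true isT.
have n00' := unit_count_hub_set.
have c10 : unit_count (~: hub_set) true false = #|F|.-1.
  apply: unit_count_full => u /negPf u0.
  by rewrite mem_eltC mem_elt_hub_set /is_vertex /hub_elt u0.
have c01 : unit_count (~: hub_set) false true = #|F|.-1.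
  apply: unit_count_full => u /negPf u0.
  by rewrite mem_eltC mem_elt_hub_set /is_vertex /hub_elt u0.
have hA : mem_elt hub_set true false 0
  by rewrite mem_elt_hub_set /is_vertex /hub_elt eqxx.
have hB : mem_elt hub_set false true 0
  by rewrite mem_elt_hub_set /is_vertex /hub_elt eqxx.
have hD : mem_elt hub_set true true 0 = false by rewrite mem_elt_hub_set /hub_elt andbF.
have cA : mem_elt (~: hub_set) true false 0 = false by rewrite mem_eltC hA andbF.
have cB : mem_elt (~: hub_set) false true 0 = false by rewrite mem_eltC hB andbF.
have cD : mem_elt (~: hub_set) true true 0 by rewrite mem_eltC hD /is_vertex eqxx.
split; apply/gda_eltP; split.
- by exists true, false, 0.
- move=> a b u; have [->|u0] := eqVneq u 0; case: a b => [] []; rewrite ?hA ?hB //.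
  (* (1,1,0) is adjacent only to the (0,0,u), so one of them must be kept even when |F| = 2. *)
  + by rewrite elt_deg110 => _; lia.
  + by rewrite /is_vertex eqxx.
  + by rewrite /is_vertex (negPf u0).
  + by rewrite elt_deg10u // hB orbT.
  + by rewrite elt_deg01u // hA orbT.
  + by rewrite elt_deg00u // hA orbT.
- move=> a b u; rewrite mem_elt_hub_set /hub_elt.
  case: a b => [] [] /andP[].
  + by move=> _ /andP[].
  (* The condition is m <= c + 1, with equality when |F| > 2. *)
  + by move=> _ /andP[_ /eqP->]; rewrite !elt_deg100 hB cB; lia.
  + by move=> _ /andP[_ /eqP->]; rewrite !elt_deg010 hA cA; lia.
  + by case/andP=> u0 _ _; rewrite !elt_deg00u // hA hB hD cA cB cD.
- by exists true, true, 0.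
- move=> a b u; have [->|u0] := eqVneq u 0; case: a b => [] []; rewrite ?cD //.
  + by rewrite elt_deg100 c01 => _; lia.
  + by rewrite elt_deg010 c10 => _; lia.
  + by rewrite /is_vertex eqxx.
  + by rewrite /is_vertex (negPf u0).
  + by rewrite mem_eltC mem_elt_hub_set /hub_elt (negPf u0) !andbF => ->.
  + by rewrite mem_eltC mem_elt_hub_set /hub_elt (negPf u0) !andbF => ->.
  + by rewrite elt_deg00u // cD addn1 orbT.
- move=> a b u; rewrite setCK; have [->|u0] := eqVneq u 0; case: a b => [] [] //.
  (* [F4] enters here: for c = m - 1 the condition c <= (m - c) + 1 reads m <= 3. *)
  + by rewrite !elt_deg110 => _; move: n00'; case: eqVneq; lia.
  + by rewrite cA.
  + by rewrite cB.
  + by rewrite mem_elt000.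
  + by move/mem_elt_vertex; rewrite /is_vertex (negPf u0).
  (* The single neighbor of a leaf is on the other side; the [+ 1] absorbs it. *)
  + by rewrite !elt_deg10u // hB cB.
  + by rewrite !elt_deg01u // hA cA.
  + by rewrite !elt_deg00u // hA hB hD cA cB cD.
Qed.

(** The leaf is (1,0,1): a vertex that it annihilates has first and third coordinates 0, so it is
    (0,1,0). *)
Lemma ex_leaf : exists x y : G, neighbors x = [set y].
Proof.
have [|x xE] := @ex_vertex true false 1; first by rewrite /is_vertex oner_eq0.
have [|y yE] := @ex_vertex false true 0; first by rewrite /is_vertex eqxx.
exists x, y; apply/setP => z; rewrite mem_neighbors inE -val_eqE.
have [a [b [u [vz zE]]]] := vertex_elt z.
rewrite xE yE zE mul_elt elt_eq0 /= !eq_elt mul1r.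
move: vz {zE}; rewrite /is_vertex; have [->|u0] := eqVneq u 0;
  by case: a b => [] []; rewrite ?eqxx ?(eq_sym _ 0) ?oner_eq0 ?andbF.
Qed.

End Graph.

Theorem theorem3p15 (F : finFieldType) :
  (#|F| <= 4 ->
     gda_partitionable (zero_divisor_graph ('Z_2 * 'Z_2 * F)%type) /\
     psi_g (zero_divisor_graph ('Z_2 * 'Z_2 * F)%type) = 2) /\
  (4 < #|F| ->
     ~ gda_partitionable (zero_divisor_graph ('Z_2 * 'Z_2 * F)%type)).
Proof.
have [x [y leaf]] := ex_leaf F.
split=> [F4|]; last first.
  rewrite ltnNge => /negP F4 /(gda_partitionable_leaf leaf)[S gS gC].
  exact: F4 (card_le4_of_gda_setC gS gC).
have [gS gC] := gda_hub_set F4.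
have part := gda_partitionable_setC gS gC.
by split=> //; apply/anti_leq; rewrite (psi_g_leaf leaf).
Qed.
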